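(* Let $d\ge 1$ be an integer. For every $N\in\mathbb{Z}_{\ge 0}$, $$g_d(N)=\sum_{k=1}^{d}(-1)^{k-1}\binom{d}{k}\binom{N+2d-k-1}{2d-k-1}.$$
   Context: Let $[d]=\{1,\dots,d\}$. A matrix $A\in\mathbb{R}^{d\times d}$ is a $G$-matrix of value $N\in\mathbb{R}_{\ge 0}$ if all its entries are nonnegative and $A_{1,\sigma(1)}+A_{2,\sigma(2)}+\cdots+A_{d,\sigma(d)}=N$ for every permutation $\sigma$ of $[d]$. For $N\in\mathbb{Z}_{\ge 0}$, $g_d(N)$ denotes the number of $d\times d$ $G$-matrices of value $N$ all of whose entries are integers. *)

(* Defs.v *)
From mathcomp Require Import all_boot all_order all_fingroup all_algebra.
From mathcomp Require Import finmap.
From mathcomp Require Import boolp classical_sets functions cardinality reals.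

Set Implicit Arguments.
Unset Strict Implicit.
Unset Printing Implicit Defensive.

Import Order.TTheory GRing.Theory Num.Theory.

Local Open Scope classical_set_scope.
Local Open Scope ring_scope.

Definition is_Gmatrix (R : realType) (d : nat) (N : R) (A : 'M[R]_d) : Prop :=
  [/\ 0 <= N,
      forall i j, 0 <= A i j
    & forall s : 'S_d, \sum_i A i (s i) = N].

Definition integral_Gmatrices (R : realType) (d N : nat) : set 'M[R]_d :=
  [set A | is_Gmatrix N%:R A /\ forall i j, A i j \is a Num.int].
Arguments integral_Gmatrices : clear implicits.

(* [fset_set] sends every infinite set to the empty [fset]; that junk value is
   never used here, by [integral_Gmatrices_finite] below. *)
Definition gcount (R : realType) (d N : nat) : nat :=
  #|` fset_set (integral_Gmatrices R d N)|.
Arguments gcount : clear implicits.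

Lemma integral_Gmatrices_finite (R : realType) (d N : nat) :
  finite_set (integral_Gmatrices R d N).
Proof.
pose f (B : 'M['I_N.+1]_d) : 'M[R]_d := \matrix_(i, j) (B i j : nat)%:R.
apply: (@sub_finite_set _ _ (f @` [set: 'M['I_N.+1]_d])); last first.
  exact/finite_image/finite_finset.
move=> A [[_ A0 AN] Aint].
have Anat i j : exists n : 'I_N.+1, A i j = (n : nat)%:R.
  have : A i j \is a Num.nat by rewrite natrEint Aint A0.
  move=> /natrP[n Aijn].
  have nN : (n < N.+1)%N.
    rewrite ltnS -(ler_nat R) -Aijn -(AN (tperm i j)) (bigD1 i)//= tpermL.
    by rewrite lerDl sumr_ge0.
  by exists (Ordinal nN).
exists (\matrix_(i, j) sval (cid (Anat i j))) => //.
by apply/matrixP => i j; rewrite !mxE; case: cid.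
Qed.

(* Main.v *)
Require Import Defs.
From mathcomp Require Import all_boot all_order all_algebra.
From mathcomp Require Import reals.
From mathcomp Require Import finmap all_fingroup classical_sets cardinality zify.

Import Order.TTheory GRing.Theory Num.Theory.
Local Open Scope ring_scope.

(* A matrix has constant permutation sums iff all its 2x2 exchanges
   A i j + A k l = A i l + A k j hold, so a nonnegative integer one is
   uniquely A i j = a i + b j with a, b natural and min a = 0, and its value is
   the sum of all a i and b j.  Counting the pairs (a, b) of value N and
   removing those with a everywhere positive gives
   'C(N + 2d - 1, 2d - 1) - 'C(N + d - 1, 2d - 1), and the subtracted term is
   the d-th finite difference \sum_k (-1)^k 'C(d, k) 'C(N+2d-1-k, 2d-1-k). *)

(** Pascal's rule splits each coefficient in two; shifting the index in one half turns it into the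
    [F k.+1] terms, with the sign flipped. *)
Lemma alternating_sum_binS (R : comPzRingType) (F : nat -> R) (j : nat) :
  \sum_(0 <= k < j.+2) (-1) ^+ k * 'C(j.+1, k)%:R * F k
  = \sum_(0 <= k < j.+1) (-1) ^+ k * 'C(j, k)%:R * (F k - F k.+1).
Proof.
under [RHS]eq_bigr do rewrite mulrBr.
rewrite sumrB big_nat_recl // bin0.
under eq_bigr do rewrite binS natrD mulrDr mulrDl.
rewrite big_split /= addrA; congr (_ + _); last first.
  by rewrite -sumrN; apply: eq_bigr => k _; rewrite exprS mulN1r !mulNr.
have := @big_nat_recl _ 0 +%R j.+1 0%N (fun k => (-1) ^+ k * 'C(j, k)%:R * F k).
by rewrite bin0 => <- //; rewrite big_nat_recr //= bin_small // mulr0 mul0r addr0.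
Qed.

Lemma alternating_sum_bin (a b j : nat) :
  \sum_(0 <= k < j.+1) (-1) ^+ k * 'C(j, k)%:Z * 'C(a + j - k, b + j - k)%:Z
  = 'C(a, b + j)%:Z.
Proof.
(* The coefficient is recast as [%:R], the form used in [alternating_sum_binS]. *)
under eq_bigr => k _ do rewrite -[X in _ * X * _]natz.
elim: j b => [|j IH] b.
  by rewrite big_nat1 expr0 bin0 !addn0 !subn0 !mul1r.
(* By Pascal's rule each difference is the summand for [j] with [b.+1] in place of [b]. *)
rewrite alternating_sum_binS -(addSnnS b) -IH; apply: eq_big_nat => k /andP[_ kj].
rewrite !addnS !subSS addSn !subSn; [|lia..].
by rewrite binS PoszD addrK.
Qed.

Lemma sum_mem_card (I : finType) (D : {set I}) : (\sum_i (i \in D) = #|D|)%N.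
Proof. by rewrite -sum1_card [RHS]big_mkcond; apply: eq_bigr => i _; case: ifP. Qed.

(** Stars and bars: subtracting 1 at each point of [D] leaves an arbitrary function of sum [m]. The
    bound on [k] keeps the codomain from excluding any solution. *)
Lemma card_ffun_sum_pos (I : finType) (D : {set I}) (m k : nat) :
  (0 < #|I|)%N -> (#|D| + m <= k)%N ->
  #|[set f : {ffun I -> 'I_k.+1} |
      (\sum_i f i == #|D| + m)%N && [forall i in D, 0 < f i]%N]|
  = 'C(m + #|I|.-1, #|I|.-1).
Proof.
move=> I0 Dmk; rewrite (addnC m) -card_ord_partitions prednK //.
pose h (t : #|I|.-tuple 'I_m.+1) : {ffun I -> 'I_k.+1} :=
  [ffun i => inord (tnth t (enum_rank i) + (i \in D))].
have hE t i : h t i = (tnth t (enum_rank i) + (i \in D))%N :> nat.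
  rewrite ffunE inordK // ltnS; apply: leq_trans Dmk; rewrite addnC.
  apply: leq_add; last by rewrite -ltnS.
  by case: (boolP (i \in D)) => // iD; rewrite (cardD1 i) iD.
have hsum t : (\sum_i h t i = #|D| + \sum_(x <- t) x)%N.
  under eq_bigr => i _ do rewrite hE.
  rewrite big_split /= addnC; congr (_ + _)%N.
    exact: sum_mem_card.
  rewrite big_tuple (reindex (@enum_rank I)) //.
  by apply: onW_bij; exact: enum_rank_bij.
have hinj : injective h.
  move=> t u tu; apply: eq_from_tnth => i; apply: val_inj.
  move: (hE t (enum_val i)); rewrite tu hE enum_valK => /eqP.
  by rewrite eqn_add2r => /eqP.
rewrite -(card_imset _ hinj); apply: eq_card => f; rewrite !inE.
apply/andP/imsetP => [[/eqP fs /forall_inP fD]|[t]]; last first.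
  rewrite inE => /eqP ts ->; split; first by rewrite hsum ts.
  by apply/forall_inP => i iD; rewrite hE iD addn1.
have Df i : ((i \in D) <= f i)%N by case: (boolP (i \in D)) => // /fD.
pose g i := (f i - (i \in D))%N.
have fg i : (f i = g i + (i \in D) :> nat)%N by rewrite /g subnK.
have gs : (\sum_i g i = m)%N.
  apply/(@addnI #|D|); rewrite -fs.
  under [RHS]eq_bigr => i _ do rewrite fg.
  by rewrite big_split /= addnC sum_mem_card.
have gm i : (g i < m.+1)%N by rewrite ltnS -gs (bigD1 i) //= leq_addr.
pose t := [tuple Ordinal (gm (enum_val i)) | i < #|I|].
have fht : f = h t.
  apply/ffunP => i; apply: val_inj.
  by rewrite /= hE tnth_mktuple /= enum_rankK fg.
by exists t => //; rewrite inE -(eqn_add2l #|D|) -hsum -fht fs.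
Qed.

Lemma perm_map2 {T : finType} {i j k l : T} :
  i != k -> j != l -> exists s : {perm T}, s i = j /\ s k = l.
Proof.
(* The first factor sends [i] to [j]; the second corrects the image of [k] and fixes [j]. *)
move=> ik jl; exists (tperm i j * tperm (tperm i j k) l)%g.
rewrite !permM tpermL tpermL tpermD //; last by rewrite eq_sym.
by rewrite -(inj_eq (@perm_inj _ (tperm i j))) tpermK tpermR eq_sym.
Qed.

(** Take [s] with [s i = j] and [s k = l]. It agrees with [s * tperm j l] off [i] and [k], so
    equating the two sums leaves just these four entries. *)
Lemma Gmatrix_exchange {R : realType} {d : nat} {N : R} {A : 'M[R]_d}
    (i j k l : 'I_d) :
  is_Gmatrix N A -> A i j + A k l = A i l + A k j.
Proof.
move=> [_ _ AN].
have [->|ik] := eqVneq i k; first by rewrite addrC.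
have [-> //|jl] := eqVneq j l.
have [s [si sk]] := perm_map2 ik jl.
have := AN (s * tperm j l)%g; rewrite -(AN s).
rewrite (bigD1 i) //= (bigD1 k) 1?eq_sym //= => /esym.
rewrite (bigD1 i) //= (bigD1 k) 1?eq_sym //= !permM si sk tpermL tpermR !addrA.
under [X in _ = _ + X]eq_bigr => x /andP[xi xk].
  rewrite permM tpermD; last 2 first.
  - by rewrite -si (inj_eq perm_inj) eq_sym.
  - by rewrite -sk (inj_eq perm_inj) eq_sym.
  over.
by move/addIr.
Qed.

Section SumMatrix.
Variables (R : realType) (d N : nat).
Hypothesis d_gt0 : (0 < d)%N.

(** The pair (a, b) is stored as one function on a disjoint union, so that stars and bars applies to
    its 2d values at once. *)
Definition sum_matrix (f : {ffun 'I_d + 'I_d -> 'I_N.+1}) : 'M[R]_d :=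
  \matrix_(i, j) (f (inl i) + f (inr j))%:R.

Definition reduced_pairs : {set {ffun 'I_d + 'I_d -> 'I_N.+1}} :=
  [set f : {ffun 'I_d + 'I_d -> 'I_N.+1} |
    (\sum_x f x == N)%N && [exists i, f (inl i) == ord0]].

Lemma sum_matrix_inj : {in reduced_pairs &, injective sum_matrix}.
Proof.
move=> f g; rewrite !inE => /andP[_ /existsP[i /eqP fi]].
move=> /andP[_ /existsP[k /eqP gk]] fg.
have E a b : (f (inl a) + f (inr b) = g (inl a) + g (inr b))%N.
  apply/eqP; rewrite -(eqr_nat R); apply/eqP.
  by have := congr1 (fun M : 'M_d => M a b) fg; rewrite !mxE.
have Er b : f (inr b) = g (inr b) :> nat.
  (* Row [i], where [f] vanishes, gives [f (inr b) >= g (inr b)]; row [k] gives the converse. *)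
  by have := E i b; have := E k b; rewrite fi gk /=; lia.
apply/ffunP => -[a|b]; apply: val_inj => /=; last exact: Er.
by have := E a i; rewrite Er => /addIn.
Qed.

Lemma integral_Gmatrices_sum_matrix (A : 'M[R]_d) :
  integral_Gmatrices R d N A <->
  exists2 f, f \in reduced_pairs & A = sum_matrix f.
Proof.
split=> [[AG Aint]|[f + ->]]; last first.
  rewrite inE => /andP[/eqP fN _]; split; last first.
    by move=> i j; rewrite mxE; apply: natr_int.
  split=> // [i j|s]; first by rewrite mxE.
  under eq_bigr do rewrite mxE.
  rewrite -natr_sum big_split /=; congr (_%:R).
  rewrite -[RHS]fN big_sumType /=; congr (_ + _)%N.
  by rewrite [RHS](reindex_inj (@perm_inj _ s)).
have [_ A0 AN] := AG.
have {Aint}[n nE] :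
    exists n : 'I_d -> 'I_d -> nat, forall i j, A i j = (n i j)%:R.
  have An i j : exists m : nat, A i j == m%:R.
    have /natrP[m ->] : A i j \is a Num.nat by rewrite natrEint Aint A0.
    by exists m.
  by exists (fun i j => xchoose (An i j)) => i j; apply/eqP/(xchooseP (An i j)).
have nX i j k l : (n i j + n k l = n i l + n k j)%N.
  by apply/eqP; rewrite -(eqr_nat R) !natrD -!nE (Gmatrix_exchange i j k l AG).
pose j0 := Ordinal d_gt0.
(* Minimality of row [i0] in column [j0] makes the truncated subtraction in [F] exact, and
   [F (inl i0)] is zero. *)
have [i0 _ i0min] := arg_minnP (fun i => n i j0) (erefl (xpredT j0)).
pose F (x : 'I_d + 'I_d) :=
  match x with inl i => n i j0 - n i0 j0 | inr j => n i0 j end%N.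
have FE i j : (F (inl i) + F (inr j) = n i j)%N.
  by have := nX i j i0 j0; have := i0min i isT; rewrite /F; lia.
have FN : (\sum_x F x = N)%N.
  (* Pairing [inl i] with [inr i] gives the diagonal sum, the value at the identity permutation. *)
  rewrite big_sumType -[LHS]big_split (eq_bigr _ (fun i _ => FE i i)).
  apply/eqP; rewrite -(eqr_nat R) -(AN 1%g) natr_sum; apply/eqP.
  by apply: eq_bigr => i _; rewrite perm1 nE.
have Flt x : (F x < N.+1)%N by rewrite ltnS -FN (bigD1 x) //= leq_addr.
exists [ffun x => Ordinal (Flt x)].
  rewrite inE; apply/andP; split.
    by apply/eqP; rewrite -[RHS]FN; apply: eq_bigr => x _; rewrite ffunE.
  by apply/existsP; exists i0; rewrite ffunE -val_eqE /= subnn.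
by apply/matrixP => i j; rewrite mxE !ffunE nE -FE.
Qed.

Lemma gcount_reduced_pairs : gcount R d N = #|reduced_pairs|.
Proof.
rewrite /gcount.
have -> : fset_set (integral_Gmatrices R d N)
    = [fset sum_matrix f | f in reduced_pairs]%fset.
  apply/fsetP => A; rewrite in_fset_set; last exact: integral_Gmatrices_finite.
  apply/idP/imfsetP => /=.
    by rewrite inE => /integral_Gmatrices_sum_matrix.
  by move=> H; rewrite inE; apply/integral_Gmatrices_sum_matrix.
by rewrite card_in_imfset; [rewrite cardE | exact: sum_matrix_inj].
Qed.

(** [T] holds all pairs of value [N] and [P] those with a everywhere positive, so the reduced pairs
    are [T] minus [P]. *)
Lemma card_reduced_pairs :
  (#|reduced_pairs| + 'C(N + d - 1, 2 * d - 1) = 'C(N + 2 * d - 1, 2 * d - 1))%N.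
Proof.
have I0 : (0 < #|{: 'I_d + 'I_d}|)%N by rewrite card_sum card_ord; lia.
have Ipred : (#|{: 'I_d + 'I_d}|.-1 = 2 * d - 1)%N.
  by rewrite card_sum card_ord; lia.
pose L : {set 'I_d + 'I_d} := [set inl i | i in 'I_d].
have cL : #|L| = d by rewrite card_imset ?card_ord //; apply: inl_inj.
pose T := [set f : {ffun 'I_d + 'I_d -> 'I_N.+1} | \sum_x f x == N]%N.
pose P := [set f : {ffun 'I_d + 'I_d -> 'I_N.+1} | [forall i in L, 0 < f i]%N].
have cT : #|T| = 'C(N + 2 * d - 1, 2 * d - 1).
  have -> : (N + 2 * d - 1 = N + (2 * d - 1))%N by lia.
  rewrite -Ipred -(@card_ffun_sum_pos _ finset.set0 N N) ?cards0 //.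
  apply: eq_card => f; rewrite !inE add0n.
  rewrite [X in _ && X](_ : _ = true) ?andbT //.
  by apply/forall_inP => x; rewrite inE.
have cTP : #|T :&: P| = 'C(N + d - 1, 2 * d - 1).
  (* If [N < d], positivity on [L] forces a sum of at least [d], so the set is empty, and the
     binomial vanishes too. *)
  have [dN|Nd] := leqP d N; last first.
    rewrite bin_small; last by lia.
    apply/eqP; rewrite cards_eq0; apply/eqP/setP => f; rewrite !inE.
    apply/negP => /andP[/eqP fN /forall_inP fL].
    suff : (d <= \sum_x f x)%N by rewrite fN leqNgt Nd.
    rewrite -{1}cL -sum1_card [leqRHS](bigID (mem L)) /=.
    by apply: leq_trans (leq_addr _ _); apply: leq_sum.
  have -> : (N + d - 1 = (N - d) + (2 * d - 1))%N by lia.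
  rewrite -Ipred -(@card_ffun_sum_pos _ L (N - d) N) // cL subnKC //.
  by apply: eq_card => f; rewrite !inE.
rewrite -cT -cTP -(cardsID P T) addnC; congr (_ + _)%N.
apply: eq_card => f; rewrite !inE andbC; congr (_ && _).
rewrite negb_forall_in; apply/existsP/exists_inP.
  by move=> [i /eqP fi]; exists (inl i); rewrite ?imset_f // fi.
by move=> [x /imsetP[i _ ->]]; rewrite -eqn0Ngt => fi; exists i.
Qed.

End SumMatrix.

Theorem mainTheorem3 (R : realType) (d : nat) (hd : (1 <= d)%N) (N : nat) :
  (gcount R d N)%:Z =
    \sum_(1 <= k < d.+1)
      (-1) ^+ (k - 1) * 'C(d, k)%:Z * 'C(N + 2 * d - k - 1, 2 * d - k - 1)%:Z.
Proof.
rewrite gcount_reduced_pairs //.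
(* With these parameters the [k = 0] term counts all pairs and the right side counts those removed;
   the remaining terms are the negated target sum. *)
have := alternating_sum_bin (N + d - 1) (d - 1) d.
rewrite big_nat_recl // bin0 expr0 !mul1r !subn0.
have -> : (N + d - 1 + d = N + 2 * d - 1)%N by lia.
have -> : (d - 1 + d = 2 * d - 1)%N by lia.
rewrite big_add1 /=.
have -> : \sum_(0 <= k < d) (-1) ^+ k.+1 * 'C(d, k.+1)%:Z *
      'C(N + 2 * d - 1 - k.+1, 2 * d - 1 - k.+1)%:Z
    = - \sum_(0 <= k < d) (-1) ^+ (k.+1 - 1) * 'C(d, k.+1)%:Z *
      'C(N + 2 * d - k.+1 - 1, 2 * d - k.+1 - 1)%:Z.
  rewrite -sumrN; apply: eq_bigr => k _.
  by rewrite exprS mulN1r !mulNr (subn1 k.+1) !(subnAC _ k.+1).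
rewrite -(card_reduced_pairs d N hd) PoszD addrAC => /(canRL (addrK _)).
by rewrite subrr => /eqP; rewrite subr_eq0 => /eqP.
Qed.
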